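(* Let $(G,\theta)$ be a $2$-oriented profinite group satisfying formal Hilbert 90 and let $\chi_1,\chi_2,\chi_3\in H^1(G,\mathbb Z/2\mathbb Z)$. If the mod $2$ Massey product $\langle\chi_1,\chi_2,\chi_3,\chi_1\rangle$ is defined, then it vanishes.
   Context: A $p$-oriented profinite group is a pair $(G,\theta)$ with $G$ a profinite group and $\theta\colon G\to\mathbb Z_p^\times$ a continuous homomorphism. For $n\geq 1$, $\mathbb Z/p^n\mathbb Z(1)$ denotes the discrete $G$-module $\mathbb Z/p^n\mathbb Z$ with $g\cdot v=\theta(g)v$. $(G,\theta)$ satisfies formal Hilbert 90 if for every open subgroup $H\subset G$ and every $n\geq1$ the reduction map $H^1(H,\mathbb Z/p^n\mathbb Z(1))\to H^1(H,\mathbb Z/p\mathbb Z(1))$ is surjective. Here $p=2$ and $\mathbb Z/2\mathbb Z$ has trivial action. Massey products: For a differential graded ring $(A,\partial)$ and $a_1,\dots,a_n\in H^1(A)$, a defining system for $\langle a_1,\dots,a_n\rangle$ is a collection of elements $a_{ij}\in A^1$, $1\le i<j\le n+1$, $(i,j)\ne(1,n+1)$, with $\partial a_{i,i+1}=0$, $a_{i,i+1}$ representing $a_i$, and $\partial(a_{ij})=-\sum_{l=i+1}^{j-1}a_{il}a_{lj}$ for $i<j-1$; its value is the class of $-\sum_{l=2}^n a_{1l}a_{l,n+1}$ in $H^2(A)$. The Massey product $\langle a_1,\dots,a_n\rangle\subset H^2(A)$ is the set of all values of defining systems; it is defined if nonempty and vanishes if it contains $0$. Mod $2$ Massey products for $G$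 are taken in the differential graded ring of continuous inhomogeneous cochains $C^*(G,\mathbb Z/2\mathbb Z)$ with cup product. *)

(* Defs.v *)
From HB Require Import structures.
From mathcomp Require Import all_boot all_order all_algebra.
From mathcomp Require Import all_classical topology.
Set Implicit Arguments. Unset Strict Implicit. Unset Printing Implicit Defensive.
Import Order.TTheory GRing.Theory.
Local Open Scope classical_set_scope.

Definition is_group (G : Type) (mul : G -> G -> G) (inv : G -> G) (one : G) :=
  [/\ forall x y z, mul x (mul y z) = mul (mul x y) z,
      forall x, mul one x = x, forall x, mul x one = x,
      forall x, mul (inv x) x = one & forall x, mul x (inv x) = one].

Definition is_profinite_group (G : topologicalType)
    (mul : G -> G -> G) (inv : G -> G) (one : G) :=
  is_group mul inv one /\
  continuous (fun p : G * G => mul p.1 p.2) /\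
  continuous inv /\
  compact [set: G] /\ hausdorff_space G /\ totally_disconnected [set: G].

Definition is_open_subgroup (G : topologicalType)
    (mul : G -> G -> G) (inv : G -> G) (one : G) (H : set G) :=
  [/\ open H, H one, forall x y, H x -> H y -> H (mul x y) & forall x, H x -> H (inv x)].

(* continuity into a discrete module = local constancy; on a subspace H *)
Definition cont_on (G : topologicalType) (T : Type) (H : set G) (f : G -> T) :=
  forall h, H h -> \forall x \near h, H x -> f x = f h.

(* continuity of a 2-cochain G x G -> T (product topology, T discrete) *)
Definition cont2 (G : topologicalType) (T : Type) (f : G -> G -> T) :=
  forall g h, \forall p \near (g, h), f p.1 p.2 = f g h.

Definition Z2_compat (x : forall n : nat, 'Z_(2 ^ n.+1)) :=
  forall n, ((x n.+1 : nat) %% 2 ^ n.+1)%N = (x n : nat).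
Definition Z2adic := {x : forall n : nat, 'Z_(2 ^ n.+1) | Z2_compat x}.
Definition Z2proj (x : Z2adic) (n : nat) : 'Z_(2 ^ n.+1) := proj1_sig x n.

(* 2-orientation: continuous homomorphism theta : G -> Z_2^x.  Z_2 carries the
   inverse-limit topology, so continuity means each reduction is locally constant;
   multiplication in Z_2 is componentwise; the units of Z_2 are the x with x = 1 mod 2. *)
Definition is_2_orientation (G : topologicalType)
    (mul : G -> G -> G) (theta : G -> Z2adic) :=
  [/\ forall g h n, Z2proj (theta (mul g h)) n = (Z2proj (theta g) n * Z2proj (theta h) n)%R,
      forall g, Z2proj (theta g) 0 = 1%R
    & forall n, cont_on [set: G] (fun g => Z2proj (theta g) n)].

Definition cocycle1_tw (G : topologicalType) (mul : G -> G -> G) (theta : G -> Z2adic)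
    (H : set G) (n : nat) (c : G -> 'Z_(2 ^ n.+1)) :=
  cont_on H c /\
  forall g h, H g -> H h -> c (mul g h) = (c g + Z2proj (theta g) n * c h)%R.

Definition red2 (n : nat) (v : 'Z_(2 ^ n.+1)) : 'Z_2 := inZp (v : nat).

(* For all open H and all n >= 1 (written n = m+1), H^1(H, Z/2^n(1)) -> H^1(H, Z/2(1))
   is surjective: every continuous cocycle mod 2 is cohomologous (differs by a
   coboundary h |-> theta(h) v - v) to the reduction of a cocycle mod 2^n. *)
Definition formal_Hilbert90 (G : topologicalType)
    (mul : G -> G -> G) (inv : G -> G) (one : G) (theta : G -> Z2adic) :=
  forall (H : set G), is_open_subgroup mul inv one H ->
  forall (m : nat) (phi : G -> 'Z_(2 ^ 0.+1)),
    cocycle1_tw mul theta H phi ->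
    exists c : G -> 'Z_(2 ^ m.+1),
      cocycle1_tw mul theta H c /\
      exists v : 'Z_(2 ^ 0.+1), forall h, H h ->
        (red2 (c h) - (phi h : 'Z_2) = Z2proj (theta h) 0 * v - v)%R.

(* inhomogeneous differentials (trivial action) *)
Definition d0 (G : Type) (v : 'Z_2) : G -> 'Z_2 := fun _ => (v - v)%R.
Definition d1 (G : Type) (mul : G -> G -> G) (a : G -> 'Z_2) : G -> G -> 'Z_2 :=
  fun g h => (a h - a (mul g h) + a g)%R.
Definition cup11 (G : Type) (a b : G -> 'Z_2) : G -> G -> 'Z_2 :=
  fun g h => (a g * b h)%R.

Definition defining_system (G : topologicalType) (mul : G -> G -> G) (n : nat)
    (chi : nat -> G -> 'Z_2) (a : nat -> nat -> G -> 'Z_2) :=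
  [/\ forall i j, (1 <= i)%N -> (i < j)%N -> (j <= n.+1)%N -> (i, j) <> (1%N, n.+1) ->
        cont_on [set: G] (a i j),
      forall i, (1 <= i <= n)%N ->
        (forall g h, d1 mul (a i i.+1) g h = 0%R) /\
        exists v : 'Z_2, forall g, (a i i.+1 g - chi i g)%R = @d0 G v g
    & forall i j, (1 <= i)%N -> (i.+1 < j)%N -> (j <= n.+1)%N -> (i, j) <> (1%N, n.+1) ->
        forall g h, d1 mul (a i j) g h
                    = (- \sum_(i.+1 <= l < j) cup11 (a i l) (a l j) g h)%R].

Definition massey_value (G : Type) (n : nat) (a : nat -> nat -> G -> 'Z_2) : G -> G -> 'Z_2 :=
  fun g h => (- \sum_(2 <= l < n.+1) cup11 (a 1%N l) (a l n.+1) g h)%R.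

Definition massey_defined (G : topologicalType) (mul : G -> G -> G) (n : nat)
    (chi : nat -> G -> 'Z_2) :=
  exists a, defining_system mul n chi a.

Definition massey_vanishes (G : topologicalType) (mul : G -> G -> G) (n : nat)
    (chi : nat -> G -> 'Z_2) :=
  exists a, defining_system mul n chi a /\
    exists b : G -> 'Z_2, cont_on [set: G] b /\
      forall g h, massey_value n a g h = d1 mul b g h.

(* continuous 1-cocycles G -> Z/2 (trivial action); these represent H^1(G, Z/2),
   which here equals Z^1 since B^1 = 0 *)
Definition cocycle1 (G : topologicalType) (mul : G -> G -> G) (chi : G -> 'Z_2) :=
  cont_on [set: G] chi /\ forall g h, d1 mul chi g h = 0%R.

(* the list chi1, chi2, chi3, chi1 indexed from 1 *)
Definition seq4 (G : Type) (c1 c2 c3 : G -> 'Z_2) (i : nat) : G -> 'Z_2 :=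
  match i with 2 => c2 | 3 => c3 | _ => c1 end.

(* Main.v *)
(* Write a, b, c for chi1, chi2, chi3 and p, q, d, f, e for the entries a13, a24,
a35, a14, a25 of a defining system.  Since both ends of the product are equal to a,
the triple (c, d, a) makes G act on the right on the row vectors (1, i, j), that
is, on E = (Z/2)^2, and the whole defining system is encoded in a Z/2-valued cocycle
on E whose restriction to a stabilizer is the character f + e + a q.  Formal Hilbert
90 and Shapiro's lemma lift this cocycle, and the cocycle (u, g) |-> p(g) + u b(g) on
the G-set Z/2 with translation by a, to coefficients Z/4(1); only this case n = 2 of
formal Hilbert 90 is used.  The sum of the first lift over E is twice a character x.
The sum of the first lift over a pair of points (0, i), (1, j) agrees modulo 2 with
the second lift at i + j, so the difference is twice a Z/2-cocycle kap on such pairs,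
and kap(i, j) + kap(i + 1, j + 1) = p + (i + j) b + x.  In field language: after
replacing p by p + x, the class of p over F(sqrt a) becomes a norm from the extension
cut out by d, so that its cup product with d vanishes.  The functions kap(0, 0) and
kap(0, 0) + kap(0, 1) then correct the defining system by explicit formulas. *)
Require Import Defs.
From Stdlib Require Import Ring Bool.
From mathcomp Require Import all_boot all_order all_algebra.
From mathcomp Require Import all_classical topology.
Set Implicit Arguments. Unset Strict Implicit. Unset Printing Implicit Defensive.
Import GRing.Theory.
Local Open Scope classical_set_scope.
Local Open Scope ring_scope.

(** * Arithmetic in Z/2 and Z/4 *)

Local Notation Z4 := 'Z_(2 ^ 1.+1).

Definition lift4 (y : 'Z_2) : Z4 := inZp y.
Definition double4 (y : 'Z_2) : Z4 := inZp y.*2.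
Definition half4 (z : Z4) : 'Z_2 := inZp z./2.

Lemma Z4_ind (P : Z4 -> Prop) : P 0 -> P 1 -> P (1 + 1) -> P (1 + 1 + 1) -> forall z, P z.
Proof.
move=> P0 P1 P2 P3 [[|[|[|[|n]]]] hn] //.
- by rewrite (_ : Ordinal hn = 0) //; apply: val_inj.
- by rewrite (_ : Ordinal hn = 1) //; apply: val_inj.
- by rewrite (_ : Ordinal hn = 1 + 1) //; apply: val_inj.
- by rewrite (_ : Ordinal hn = 1 + 1 + 1) //; apply: val_inj.
Qed.

Lemma Z2_ind (P : 'Z_2 -> Prop) : P 0 -> P 1 -> forall z, P z.
Proof.
move=> P0 P1 [[|[|n]] hn] //.
- by rewrite (_ : Ordinal hn = 0) //; apply: val_inj.
- by rewrite (_ : Ordinal hn = 1) //; apply: val_inj.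
Qed.

Lemma red2D (x y : Z4) : red2 (x + y) = red2 x + red2 y.
Proof. by elim/Z4_ind: x; elim/Z4_ind: y; apply: val_inj. Qed.

Lemma red2N (x : Z4) : red2 (- x) = red2 x.
Proof. by elim/Z4_ind: x; apply: val_inj. Qed.

Lemma red2M (x y : Z4) : red2 (x * y) = red2 x * red2 y.
Proof. by elim/Z4_ind: x; elim/Z4_ind: y; apply: val_inj. Qed.

Lemma lift4K y : red2 (lift4 y) = y.
Proof. by elim/Z2_ind: y; apply: val_inj. Qed.

Lemma half4K z : red2 z = 0 -> double4 (half4 z) = z.
Proof. by elim/Z4_ind: z => // _; apply: val_inj. Qed.

Lemma double4D x y : double4 (x + y) = double4 x + double4 y.
Proof. by elim/Z2_ind: x; elim/Z2_ind: y; apply: val_inj. Qed.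

Lemma double4_inj : injective double4.
Proof. by move=> x y; elim/Z2_ind: x; elim/Z2_ind: y. Qed.

Lemma double4_red2 z : double4 (red2 z) = z + z.
Proof. by elim/Z4_ind: z; apply: val_inj. Qed.

Lemma oppr_double4 y : - double4 y = double4 y.
Proof. by elim/Z2_ind: y; apply: val_inj. Qed.

(** Odd elements act trivially on 2Z/4, so the twist by [theta] disappears once an even cochain is
    halved. *)
Lemma unit4_mul (u : Z4) (y : 'Z_2) : red2 u = 1 -> u * double4 y = double4 y.
Proof. by elim/Z4_ind: u => //; elim/Z2_ind: y => // _; apply: val_inj. Qed.

Lemma unit4_sqr (u : Z4) : red2 u = 1 -> u * u = 1.
Proof. by elim/Z4_ind: u => // _; apply: val_inj. Qed.

Definition boolZ2 (x : 'Z_2) : bool := x != 0.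

Lemma boolZ2_inj : injective boolZ2.
Proof. by move=> x y; elim/Z2_ind: x; elim/Z2_ind: y. Qed.

Lemma boolZ2D x y : boolZ2 (x + y) = xorb (boolZ2 x) (boolZ2 y).
Proof. by elim/Z2_ind: x; elim/Z2_ind: y. Qed.

Lemma boolZ2M x y : boolZ2 (x * y) = boolZ2 x && boolZ2 y.
Proof. by elim/Z2_ind: x; elim/Z2_ind: y. Qed.

Lemma boolZ2N x : boolZ2 (- x) = boolZ2 x.
Proof. by elim/Z2_ind: x. Qed.

Lemma boolZ2_0 : boolZ2 0 = false. Proof. by []. Qed.

Lemma boolZ2_1 : boolZ2 1 = true. Proof. by []. Qed.

Lemma addZ2_11 : 1 + 1 = 0 :> 'Z_2. Proof. exact: val_inj. Qed.

Lemma addrr_Z2 (x : 'Z_2) : x + x = 0.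
Proof. by elim/Z2_ind: x; rewrite ?(addr0, addZ2_11). Qed.

Lemma addZ2_move (x y z : 'Z_2) : x + y = z -> y = x + z.
Proof. by move=> <-; rewrite addrA addrr_Z2 add0r. Qed.

(* The Stdlib ring structure on bool has coefficients in bool, so [ring] then computes
in characteristic 2. *)
Ltac to_bool :=
  apply: boolZ2_inj; rewrite ?(boolZ2D, boolZ2M, boolZ2N, boolZ2_0, boolZ2_1).

(** * Locally constant cochains *)

Definition locally_constant (G : topologicalType) (T : Type) (f : G -> T) :=
  forall g, \forall x \near g, f x = f g.

Lemma cont_onTP (G : topologicalType) (T : Type) (f : G -> T) :
  cont_on [set: G] f <-> locally_constant f.
Proof.
split=> hf g; first by apply: filterS (hf g I) => x; apply.
by move=> _; apply: filterS (hf g) => x ->.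
Qed.

Section LocallyConstant.
Context {G : topologicalType}.

Lemma locally_constant_cst (T : Type) (y : T) : locally_constant (fun _ : G => y).
Proof. by move=> g; apply: nearW. Qed.

Lemma locally_constant1 (S T : Type) (F : S -> T) (f : G -> S) :
  locally_constant f -> locally_constant (fun g => F (f g)).
Proof. by move=> hf g; apply: filterS (hf g) => x ->. Qed.

Lemma locally_constant2 (S S' T : Type) (F : S -> S' -> T) (f : G -> S) (f' : G -> S') :
  locally_constant f -> locally_constant f' -> locally_constant (fun g => F (f g) (f' g)).
Proof. by move=> hf hf' g; apply: filterS2 (hf g) (hf' g) => x -> ->. Qed.

Lemma locally_constantD (V : zmodType) (f f' : G -> V) :
  locally_constant f -> locally_constant f' -> locally_constant (fun g => f g + f' g).
Proof. exact: locally_constant2. Qed.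

Lemma locally_constantN (V : zmodType) (f : G -> V) :
  locally_constant f -> locally_constant (fun g => - f g).
Proof. exact: locally_constant1. Qed.

Lemma locally_constantM (f f' : G -> 'Z_2) :
  locally_constant f -> locally_constant f' -> locally_constant (fun g => f g * f' g).
Proof. exact: locally_constant2. Qed.

End LocallyConstant.

Ltac lc := repeat first [assumption | exact: locally_constant_cst
  | apply: locally_constantD | apply: locally_constantN | apply: locally_constantM ].

Section FormalHilbert90.
Context {G : topologicalType} {mul : G -> G -> G} {inv : G -> G} {one : G}.
Context {theta : G -> Z2adic}.
Context (hG : is_profinite_group mul inv one).
Context (htheta : is_2_orientation mul theta).
Context (hH90 : formal_Hilbert90 mul inv one theta).

Let t (g : G) : Z4 := Z2proj (theta g) 1.

Lemma mul_assoc g h k : mul g (mul h k) = mul (mul g h) k.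
Proof. by case: hG => -[]. Qed.

Lemma mul_one g : mul g one = g.
Proof. by case: hG => -[]. Qed.

Lemma mul_inv g : mul g (inv g) = one.
Proof. by case: hG => -[]. Qed.

Lemma inv_mul g : mul (inv g) g = one.
Proof. by case: hG => -[]. Qed.

Lemma orientation4M g h : t (mul g h) = t g * t h.
Proof. by case: htheta => tM _ _; apply: tM. Qed.

Lemma red2_orientation4 g : red2 (t g) = 1.
Proof.
case: htheta => _ h1 _; have := proj2_sig (theta g) 0.
rewrite -/(Z2proj (theta g) 1) -/(Z2proj (theta g) 0) h1 => h.
by apply: val_inj; rewrite /= h.
Qed.

Lemma locally_constant_orientation4 : locally_constant t.
Proof. by apply/cont_onTP; case: htheta. Qed.

Lemma continuous_mull k : continuous (mul k).
Proof.
move=> g; case: hG => _ [hm _].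
exact: (@continuous2_cvg G G G G (nbhs g) _ (fun=> k) id mul k g (hm (k, g))
  (cvg_cst _) cvg_id).
Qed.

Lemma continuous_mulr k : continuous (mul^~ k).
Proof.
move=> g; case: hG => _ [hm _].
exact: (@continuous2_cvg G G G G (nbhs g) _ id (fun=> k) mul g k (hm (g, k))
  cvg_id (cvg_cst _)).
Qed.

(** * Lifting cocycles on a [G]-set from Z/2 to Z/4(1) *)

Section Action.
Context {X : choiceType} (act : X -> G -> X).
Context (act1 : forall x, act x one = x).
Context (actM : forall x g h, act x (mul g h) = act (act x g) h).
Context (act_lc : forall x, locally_constant (act x)).

Lemma is_open_stabilizer y : is_open_subgroup mul inv one [set g | act y g = y].
Proof.
split=> /= [|//|g h hg hh|g hg]; last 2 first.
- by rewrite actM hg.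
- by rewrite -{1}hg -actM mul_inv.
by rewrite openE => g /= hg; apply: filterS (act_lc y g) => x /= ->.
Qed.

(** Formal Hilbert 90 lifts [phi] on the stabilizer of [y] to a cocycle [c], and coset
    representatives extend it to [G] with [N (mul l g) = c l + t l * N g]. Taking differences
    eliminates [c l]. *)
Lemma stabilizer_lift y (phi : G -> 'Z_2) :
    locally_constant phi ->
    (forall l g, act y l = y -> phi (mul l g) = phi l + phi g) ->
  exists N : G -> Z4, [/\ locally_constant N, forall g, red2 (N g) = phi g &
    forall l g g', act y l = y ->
      N (mul l g) - N (mul l g') = t l * (N g - N g')].
Proof.
move=> phi_lc phiM.
have [|c [[c_lc cM] [v hv]]] := @hH90 _ (is_open_stabilizer y) 1 phi.
  split=> [g _|g h hg _]; first by apply: filterS (phi_lc g) => x ->.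
  case: htheta => _ -> _; rewrite mul1r; exact: phiM.
(* Since [theta] is 1 modulo 2, coboundaries modulo 2 vanish and the reduction is exact, not only up
   to cohomology. *)
have red_c l : act y l = y -> red2 (c l) = phi l.
  move=> hl; apply/eqP; rewrite -subr_eq0; apply/eqP.
  rewrite (hv l hl); case: htheta => _ -> _.
  by rewrite mul1r subrr.
have /choice [r hr] : forall x, exists r, (exists g, act y g = x) -> act y r = x.
  move=> x; have [[g hg]|n] := pselect (exists g, act y g = x); first by exists g.
  by exists one.
pose q g := mul g (inv (r (act y g))).
have hq g : act y (q g) = y.
  rewrite /q actM -{1}(hr (act y g)); last by exists g.
  by rewrite -actM mul_inv.
have qK g : mul (q g) (r (act y g)) = g by rewrite /q -mul_assoc inv_mul mul_one.
exists (fun g => c (q g) + t (q g) * lift4 (phi (r (act y g)))); split.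
- move=> g; near=> x.
  have hx : act y x = act y g by near: x; exact: act_lc.
  rewrite /q hx; congr (_ + _ * _).
    have hx' : act y (q x) = y by [].
    move: hx'; rewrite /q hx; near: x.
    exact: (continuous_mulr (c_lc (q g) (hq g))).
  near: x; exact: (continuous_mulr (locally_constant_orientation4 (q g))).
- move=> g; rewrite red2D red2M red2_orientation4 lift4K mul1r red_c //.
  by rewrite -phiM // qK.
- move=> l g g' hl.
  have E h : act y (mul l h) = act y h by rewrite actM hl.
  have F h : q (mul l h) = mul l (q h) by rewrite /q E -mul_assoc.
  have c_mul h : c (q (mul l h)) + t (q (mul l h)) * lift4 (phi (r (act y (mul l h)))) =
      c l + t l * (c (q h) + t (q h) * lift4 (phi (r (act y h)))).
    by rewrite F E cM // orientation4M mulrDr mulrA addrA.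
  by rewrite !c_mul [c l + _]addrC addrKA mulrBr.
Unshelve. all: by end_near.
Qed.

(** Shapiro's lemma, orbit by orbit: the cocycle is lifted at a base point by [stabilizer_lift] and
    then transported along the orbit. *)
Lemma shapiro_lift (x0 : X) (kb : X -> G -> 'Z_2) :
    (forall x, locally_constant (kb x)) ->
    (forall x g h, kb x (mul g h) = kb x g + kb (act x g) h) ->
  exists k : X -> G -> Z4, [/\ forall x, locally_constant (k x),
    forall x g, red2 (k x g) = kb x g &
    forall x g h, k x (mul g h) = k x g + t g * k (act x g) h].
Proof.
move=> kb_lc kbM.
have /choice [N hN] : forall y, exists N : G -> Z4,
    [/\ locally_constant N, forall g, red2 (N g) = kb y g &
    forall l g g', act y l = y -> N (mul l g) - N (mul l g') = t l * (N g - N g')].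
  by move=> y; apply: stabilizer_lift => // l g hl; rewrite kbM hl.
pose orb x := [set y | exists g, act y g = x].
have orbE x g : orb (act x g) = orb x.
  apply/seteqP; split=> y [h hy]; last by exists (mul h g); rewrite actM hy.
  by exists (mul h (inv g)); rewrite actM hy -actM mul_inv.
pose base x := xget x0 (orb x).
have baseE x g : base (act x g) = base x by rewrite /base orbE.
have /choice [r hr] : forall x, exists g, act (base x) g = x.
  by move=> x; apply: (@xgetPex _ x0 (orb x)); exists x, one.
(* This solves the cocycle relation along the path from the base point to [x] given by [r x]; the
   unit [t (r x)] is its own inverse in Z/4. *)
pose k x g := t (r x) * (N (base x) (mul (r x) g) - N (base x) (r x)).
have t_sqr g : t g * t g = 1 by apply: unit4_sqr; apply: red2_orientation4.
exists k; split.
- move=> x; apply: (@locally_constant1 _ _ _ (fun z => t (r x) * (z - N (base x) (r x)))).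
  by move=> g; have [N_lc _ _] := hN (base x); apply: (continuous_mull (N_lc _)).
- move=> x g; have [_ NE _] := hN (base x).
  rewrite red2M red2_orientation4 mul1r red2D red2N !NE kbM hr.
  by to_bool; ring.
- move=> x g h; have [_ _ NM] := hN (base x); rewrite /k baseE.
  (* [l] is the loop from the base point to [x], on to [y] by [g], and back. *)
  set y := act x g; pose l := mul (mul (r x) g) (inv (r y)).
  have hl : act (base x) l = base x.
    by rewrite /l actM actM hr -/y -{1}(hr y) baseE -actM mul_inv.
  have lE : mul l (r y) = mul (r x) g by rewrite /l -mul_assoc inv_mul mul_one.
  have tlE : t l * t (r y) = t (r x) * t g by rewrite -!orientation4M lE.
  have tE : t g * t (r y) = t (r x) * t l.
    by rewrite -[t l]mulr1 -(t_sqr (r y)) [t l * _]mulrA tlE !mulrA t_sqr mul1r.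
  have lhE : mul l (mul (r y) h) = mul (r x) (mul g h) by rewrite mul_assoc lE -mul_assoc.
  by rewrite mulrA tE -mulrA -(NM l) // lhE lE -mulrDr [in RHS]addrC subrKA.
Qed.

End Action.

(** * Construction of the correcting cochains *)

(** In the application [x] is added to [p], [y] enters the new entry a14, and [z] the cochain that
    bounds the Massey value. *)
Lemma correction_cochains (a b c p q d e f : G -> 'Z_2) :
    locally_constant a -> locally_constant b -> locally_constant c ->
    locally_constant p -> locally_constant q -> locally_constant d ->
    locally_constant e -> locally_constant f ->
    (forall g h, a (mul g h) = a g + a h) ->
    (forall g h, b (mul g h) = b g + b h) ->
    (forall g h, c (mul g h) = c g + c h) ->
    (forall g h, p (mul g h) = p g + p h + a g * b h) ->
    (forall g h, q (mul g h) = q g + q h + b g * c h) ->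
    (forall g h, d (mul g h) = d g + d h + c g * a h) ->
    (forall g h, f (mul g h) = f g + f h + (a g * q h + p g * c h)) ->
    (forall g h, e (mul g h) = e g + e h + (b g * d h + q g * a h)) ->
  exists x y z : G -> 'Z_2,
    [/\ locally_constant x, locally_constant y & locally_constant z] /\
    [/\ forall g h, x (mul g h) = x g + x h,
      forall g h, y (mul g h) = y g + y h + (d g * b h + c g * (p h + x h + b h)) &
      forall g h, z (mul g h) = z g + z h + (d g * (p h + x h) + a g * y h +
        a g * d g * b h + a g * c g * (p h + x h + b h))].
Proof.
move=> a_lc b_lc c_lc p_lc q_lc d_lc e_lc f_lc aM bM cM pM qM dM fM eM.
have a1 : a one = 0 by apply: (addrI (a one)); rewrite -aM mul_one addr0.
have c1 : c one = 0 by apply: (addrI (c one)); rewrite -cM mul_one addr0.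
have d1 : d one = 0.
  by apply: (addrI (d one)); have := dM one one; rewrite mul_one c1 mul0r !addr0.
pose actE (u : 'Z_2 * 'Z_2) g := (u.1 + c g, u.2 + d g + u.1 * a g).
(* The last bracket makes the cup products in the coboundaries of e and f symmetric: its
coboundary is (b, d) + (d, b) + (a, q) + (q, a) + (c, p) + (p, c), where (r, s) is the
cochain (g, h) |-> r(g) s(h). *)
pose kb (u : 'Z_2 * 'Z_2) g := f g + e g + u.1 * p g + u.2 * b g +
  (b g * d g + a g * q g + c g * p g + a g * b g * c g).
have [|u g h|u|u|u g h|k [k_lc kE kM]] := @shapiro_lift _ actE _ _ _ (0, 0) kb.
- by case=> u v; rewrite /actE /= c1 d1 a1 mulr0 !addr0.
- rewrite /actE /= cM dM aM; congr pair; first by rewrite addrA.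
  by to_bool; ring.
- by apply: locally_constant2; lc.
- by rewrite /kb; lc.
- rewrite /kb /actE /= cM dM aM bM pM qM fM eM.
  by to_bool; ring.
have [|u g h|u|u|u g h|A [A_lc AE AM]] :=
    @shapiro_lift _ (fun u g => u + a g) _ _ _ (0 : 'Z_2) (fun u g => p g + u * b g).
- by move=> u; rewrite a1 addr0.
- by rewrite aM addrA.
- by lc.
- by lc.
- by rewrite /= bM pM; to_bool; ring.
pose kap (i j : 'Z_2) g := half4 (A (i + j) g - k (0, i) g - k (1, j) g).
have kapE (i j : 'Z_2) g : double4 (kap i j g) = A (i + j) g - k (0, i) g - k (1, j) g.
  apply: half4K; rewrite !red2D !red2N AE !kE /kb /=; to_bool; ring.
(* If [c g = 1], the images of (0, i) and (1, j) have first coordinates 1 and 0; the terms in [c g]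
   restore the order of the pair. *)
have kapM (i j : 'Z_2) g h : kap i j (mul g h) = kap i j g +
    kap (i + d g + c g * (i + j + a g)) (j + d g + a g + c g * (i + j + a g)) h.
  apply: double4_inj; rewrite double4D.
  rewrite -[double4 (kap (_ + _) _ _)](unit4_mul _ (red2_orientation4 g)) !kapE AM !kM.
  have -> : i + d g + c g * (i + j + a g) + (j + d g + a g + c g * (i + j + a g)) =
      i + j + a g by to_bool; ring.
  rewrite /actE /=; move: (c g) (d g) (a g) => cg dg ag.
  rewrite !mulrBr !opprD [A _ _ + _ + _]addrACA [LHS]addrACA; congr (_ + _).
  elim/Z2_ind: cg; rewrite ?(add0r, addr0, mul0r, mulr0, mul1r, mulr1, addZ2_11) //.
  have -> : i + dg + (i + j + ag) = j + dg + ag by to_bool; ring.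
  have -> : j + dg + ag + (i + j + ag) = i + dg by to_bool; ring.
  by rewrite addrAC.
(* Sums over the fibres of the first coordinate: [g] carries fibre i to fibre i + [c g] and only
   permutes the second coordinate. *)
pose S (i : 'Z_2) h := k (i, 0) h + k (i, 1) h.
have SE (i j : 'Z_2) h : k (i, j) h + k (i, j + 1) h = S i h.
  by elim/Z2_ind: j; rewrite ?(add0r, addr0, mul0r, mulr0, mul1r, mulr1, addZ2_11) // addrC.
have SM (i : 'Z_2) g h : S i (mul g h) = S i g + t g * S (i + c g) h.
  rewrite -(SE (i + c g) (d g + i * a g)) /S !kM /actE /= addrACA -mulrDr add0r.
  by congr (_ + _ * (_ + k (_, _) _)); rewrite -addrA addrC.
pose x g := half4 (S 0 g + S 1 g).
have xE g : double4 (x g) = S 0 g + S 1 g.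
  by apply: half4K; rewrite !red2D !kE /kb /=; to_bool; ring.
have xM g h : x (mul g h) = x g + x h.
  apply: double4_inj; rewrite double4D -[double4 (x h)](unit4_mul _ (red2_orientation4 g)).
  rewrite !xE !SM addrACA -mulrDr; congr (_ + _ * _).
  by elim/Z2_ind: (c g); rewrite ?(add0r, addr0, mul0r, mulr0, mul1r, mulr1, addZ2_11) // addrC.
(* The two pairs exhaust E, so [k] contributes twice [x]; [A (i + j)] occurs twice and contributes
   the double of its reduction. *)
have kapS (i j : 'Z_2) h : kap i j h + kap (i + 1) (j + 1) h = p h + (i + j) * b h + x h.
  apply: double4_inj; rewrite [LHS]double4D [RHS]double4D -AE double4_red2 xE !kapE.
  have -> : i + 1 + (j + 1) = i + j by to_bool; ring.
  rewrite -[S 0 h + _]xE -oppr_double4 xE -(SE 0 i) -(SE 1 j) !opprD.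
  by rewrite [LHS]addrACA [_ - k (0, i) h + _]addrACA -[LHS]addrA.
have x_lc : locally_constant x.
  by apply: locally_constant1; rewrite /S; lc; apply: k_lc.
have kap_lc (i j : 'Z_2) : locally_constant (kap i j).
  by apply: locally_constant1; lc; first [exact: A_lc | exact: k_lc].
have [z zE] : exists z, z = kap 0 0 by eexists.
have [y yE] : exists y, forall g, y g = kap 0 0 g + kap 0 1 g.
  by exists (fun g => kap 0 0 g + kap 0 1 g).
have z_lc : locally_constant z by rewrite zE.
have y_lc : locally_constant y.
  have -> : y = fun g => kap 0 0 g + kap 0 1 g by exact/funext.
  by lc.
have kap01 h : kap 0 1 h = z h + y h.
  by apply: addZ2_move; rewrite zE yE.
have kap11 h : kap 1 1 h = z h + (p h + x h).
  by apply: addZ2_move; rewrite zE; have := kapS 0 0 h; rewrite ?(add0r, addr0, mul0r).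
have kap10 h : kap 1 0 h = z h + y h + (p h + b h + x h).
  by rewrite -kap01; apply: addZ2_move; have := kapS 0 1 h; rewrite ?(add0r, addZ2_11, mul1r).
(* Interpolation of the four values, so that [kapM] becomes a polynomial identity. *)
have kap_poly (i j : 'Z_2) h :
    kap i j h = z h + (i + j) * y h + i * (p h + x h) + i * (1 + j) * b h.
  elim/Z2_ind: i; elim/Z2_ind: j; rewrite ?(add0r, addr0, mul0r, mulr0, mul1r, mulr1, addZ2_11).
  - by rewrite zE.
  - exact: kap01.
  - by rewrite kap10; to_bool; ring.
  - exact: kap11.
(* Squares of Z/2-values must be reduced by hand: [ring] only knows characteristic 2. *)
exists x, y, z; split=> //; split=> // g h;
  have idem_a := Bool.andb_diag (boolZ2 (a g));
  have idem_c := Bool.andb_diag (boolZ2 (c g));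
  have idem_d := Bool.andb_diag (boolZ2 (d g)).
- rewrite yE !kapM !kap_poly; to_bool; ring [idem_a idem_c idem_d].
- rewrite {1}zE kapM !kap_poly; to_bool; ring [idem_a idem_c idem_d].
Qed.

End FormalHilbert90.

Theorem theorem1p4 (G : topologicalType) (mul : G -> G -> G) (inv : G -> G) (one : G)
  (theta : G -> Z2adic)
  (hG : is_profinite_group mul inv one)
  (htheta : is_2_orientation mul theta)
  (hH90 : formal_Hilbert90 mul inv one theta)
  (chi1 chi2 chi3 : G -> 'Z_2)
  (h1 : cocycle1 mul chi1) (h2 : cocycle1 mul chi2) (h3 : cocycle1 mul chi3) :
  massey_defined mul 4 (seq4 chi1 chi2 chi3) ->
  massey_vanishes mul 4 (seq4 chi1 chi2 chi3).
Proof.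
move=> [s [s_lc s_diag s_d]].
have s_cst i j : [&& 0 < i, i < j, j <= 5 & (i, j) != (1, 5)]%N -> locally_constant (s i j).
  by case/and4P=> hi hij hj /eqP n; apply/cont_onTP; apply: s_lc.
have sE i : (1 <= i <= 4)%N -> forall g, s i i.+1 g = seq4 chi1 chi2 chi3 i g.
  by move=> hi g; have [_ [v /(_ g)]] := s_diag i hi; rewrite /d0 subrr => /subr0_eq.
have sM i : (1 <= i <= 4)%N -> forall g h, s i i.+1 (mul g h) = s i i.+1 g + s i i.+1 h.
  move=> hi g h; have [/(_ g h) E _] := s_diag i hi; apply: addZ2_move.
  by rewrite -[RHS]addr0 -E /d1; to_bool; ring.
have sd i j : [&& 0 < i, i.+1 < j, j <= 5 & (i, j) != (1, 5)]%N -> forall g h,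
    s i j (mul g h) = s i j g + s i j h + \sum_(i.+1 <= l < j) s i l g * s l j h.
  case/and4P=> hi hij hj /eqP n g h; have := s_d i j hi hij hj n g h; rewrite /d1 /cup11.
  by move=> /(canLR (@opprK _)) <-; to_bool; ring.
have aM := sM 1%N isT; have bM := sM 2%N isT; have cM := sM 3%N isT.
(* Here the equality of the two outer characters enters; it holds for functions because degree 1
   coboundaries are zero. *)
have aE : s 4%N 5%N = s 1%N 2%N by apply/funext => g; rewrite !sE.
have pM g h : s 1%N 3%N (mul g h) = s 1%N 3%N g + s 1%N 3%N h + s 1%N 2%N g * s 2%N 3%N h.
  by rewrite sd // big_nat1.
have qM g h : s 2%N 4%N (mul g h) = s 2%N 4%N g + s 2%N 4%N h + s 2%N 3%N g * s 3%N 4%N h.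
  by rewrite sd // big_nat1.
have dM g h : s 3%N 5%N (mul g h) = s 3%N 5%N g + s 3%N 5%N h + s 3%N 4%N g * s 1%N 2%N h.
  by rewrite sd // big_nat1 aE.
have fM g h : s 1%N 4%N (mul g h) = s 1%N 4%N g + s 1%N 4%N h +
    (s 1%N 2%N g * s 2%N 4%N h + s 1%N 3%N g * s 3%N 4%N h).
  by rewrite sd // big_ltn // big_nat1.
have eM g h : s 2%N 5%N (mul g h) = s 2%N 5%N g + s 2%N 5%N h +
    (s 2%N 3%N g * s 3%N 5%N h + s 2%N 4%N g * s 1%N 2%N h).
  by rewrite sd // big_ltn // big_nat1 aE.
have [x [y [z [[x_lc y_lc z_lc] [xM yM zM]]]]] := correction_cochains hG htheta hH90
  (s_cst 1%N 2%N isT) (s_cst 2%N 3%N isT) (s_cst 3%N 4%N isT) (s_cst 1%N 3%N isT)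
  (s_cst 2%N 4%N isT) (s_cst 3%N 5%N isT) (s_cst 2%N 5%N isT) (s_cst 1%N 4%N isT)
  aM bM cM pM qM dM fM eM.
(* Built from e, not f: the coboundaries of e and [y], with products such as b d added to exchange
   cup factors, sum to that of a14 for the new a13 = p + [x]. The term q + b c removes the stray cup
   product of c and b. *)
pose f' g := s 2%N 5%N g + s 2%N 4%N g + s 2%N 3%N g * s 3%N 4%N g + x g * s 3%N 4%N g +
  (s 2%N 3%N g * s 3%N 5%N g + s 1%N 2%N g * s 2%N 4%N g + s 3%N 4%N g * s 1%N 3%N g +
   s 1%N 2%N g * s 2%N 3%N g * s 3%N 4%N g) + y g.
pose s' i j := if (i, j) == (1, 3)%N then fun g => s 1%N 3%N g + x g
  else if (i, j) == (1, 4)%N then f' else s i j.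
exists s'; split; first split.
- move=> i j hi hij hj n; apply/cont_onTP; rewrite /s'.
  case: ifP => _; first by lc; apply: s_cst.
  case: ifP => _; first by rewrite /f'; lc; apply: s_cst.
  by apply: s_cst; rewrite hi hij hj; apply/eqP.
- move=> i hi; rewrite (_ : s' i i.+1 = s i i.+1); first exact: s_diag.
  by rewrite /s'; move: hi; case: i => [|[|[|[|]]]].
- move=> i j hi hij hj n g h.
  have : (i, j) \in [:: (1, 3); (1, 4); (2, 4); (2, 5); (3, 5)]%N.
    by move: i j hi hij hj n => [|[|[|[|[|i]]]]] [|[|[|[|[|[|j]]]]]].
  rewrite !inE => /orP[|/orP[|/orP[|/orP[|]]]] /eqP[-> ->];
    rewrite /index_iota /= !big_cons big_nil /d1 /cup11 /s' /f' /=
      ?(aE, pM, qM, dM, fM, eM, xM, yM, aM, bM, cM);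
    by to_bool; ring.
(* The products (p + [x]) d, a [y] and a e exchange the factors in the coboundary of [z] and supply
   the cup product of a and e; a b d absorbs leftover triple products. *)
- exists (fun g => z g + (s 1%N 3%N g + x g) * s 3%N 5%N g + s 1%N 2%N g * y g +
    s 1%N 2%N g * s 2%N 5%N g + s 1%N 2%N g * s 2%N 3%N g * s 3%N 5%N g); split.
    by apply/cont_onTP; lc; apply: s_cst.
  move=> g h; rewrite /massey_value /index_iota /= !big_cons big_nil /cup11 /d1 /s' /f' /= aE.
  rewrite aM bM pM dM eM xM yM zM.
  have idem_a := Bool.andb_diag (boolZ2 (s 1%N 2%N g)).
  have idem_a' := Bool.andb_diag (boolZ2 (s 1%N 2%N h)).
  to_bool; ring [idem_a idem_a'].
Qed.
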